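(* Let $U=\{0,\alpha,\beta\}$ be a set of three angles with $0<\alpha<\beta<\pi$, and let $\alpha$, $\rho=\beta-\alpha$, $\gamma=\pi-\beta$ be the corresponding triangle angles, i.e. the angles of the triangles formed by the lines of the origami structure $S(U)$. Let $G(U)$ be the symmetry group of $S(U)$. If the triangles within $S(U)$ are scalene, then $G(U)$ is the wallpaper group $p2$; if they are isosceles but not equilateral, then $G(U)$ is the wallpaper group $cmm$; if they are equilateral, then $G(U)$ is the wallpaper group $p6m$.
   Context: Identify $\mathbb{C}$ with $\mathbb{R}^2$. For $p\in\mathbb{C}$ and an angle $\alpha$, let $L_{p,\alpha}=\{p+r(\cos\alpha+i\sin\alpha): r\in\mathbb{R}\}$. Angles describe directions of lines, so they are regarded modulo $\pi$. For $p,q\in\mathbb{C}$ and distinct angles $\alpha\ne\beta$ (mod $\pi$), $[\![p,q]\!]_{\alpha,\beta}$ denotes the intersection point of $L_{p,\alpha}$ and $L_{q,\beta}$. For a finite set of angles $U$ containing $0$, put $M_1(U)=\{[\![0,1]\!]_{\alpha,\beta}:\alpha,\beta\in U,\ \alpha\neq\beta\}$ and, for $k>1$, $M_k(U)=\{[\![p,q]\!]_{\alpha,\beta}: p,q\in M_{k-1}(U),\ \alpha,\beta\in U,\ \alpha\ne\beta\}$. The origami set is $M(U)=\bigcup_k M_k(U)$ and the origami structure is $S(U)=\bigcup_{\alpha\in U}\bigcup_{p\in M(U)}L_{p,\alpha}$. $G(U)$ is the group of all isometries of the plane mapping $S(U)$ onto itself. The lines of $S(U)$ cut the plane into triangles with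 angles $\alpha,\rho,\gamma$. The names $p2$, $cmm$, $p6m$ refer to the standard crystallographic notation for the 17 isomorphism types of wallpaper groups ($p2$: highest rotation order 2 and no reflections or glide reflections; $cmm$: highest rotation order 2, centered (rhombic) lattice, reflections in two perpendicular directions; $p6m$: hexagonal lattice with rotations of order 6 and reflections). *)

(* Defs.v *)
(* The plane is R[i], over an arbitrary R : realType. *)
From HB Require Import structures.
From mathcomp Require Import all_boot all_order all_algebra.
From mathcomp Require Import all_classical all_reals all_analysis.
From mathcomp Require Export complex.

Set Implicit Arguments.
Unset Strict Implicit.
Unset Printing Implicit Defensive.

Import Order.TTheory GRing.Theory Num.Theory.

Local Open Scope classical_set_scope.
Local Open Scope ring_scope.

Section Origami.
Variable R : realType.
Implicit Types (p q r z c u v w : R[i]) (a b t : R) (U : set R).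

Definition expi a : R[i] := (cos a +i* sin a)%C.

Definition line p a : set R[i] := [set p + (t%:C)%C * expi a | t in [set: R]].

(* Angles are represented by real numbers; they describe the same direction
   of lines when they agree modulo pi. *)
Definition same_direction a b := exists k : int, a = b + k%:~R * pi.

(* z is the point written [[p,q]]_{a,b}. *)
Definition is_meet p q a b z :=
  ~ same_direction a b /\ line p a `&` line q b = [set z].

(* [origami_stage U n] is M_{n+1}(U): the stages of the construction are
   numbered from 1. *)
Fixpoint origami_stage U (n : nat) : set R[i] :=
  match n with
  | 0%N => [set z | exists a b, [/\ U a, U b & is_meet 0 1 a b z]]
  | m.+1 => [set z | exists p q a b,
      [/\ origami_stage U m p, origami_stage U m q, U a, U b
        & is_meet p q a b z]]
  end.

Definition origami_set U : set R[i] := \bigcup_n origami_stage U n.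

Definition origami_structure U : set R[i] :=
  \bigcup_(a in U) \bigcup_(p in origami_set U) line p a.

Definition isometry (f : R[i] -> R[i]) := forall p q, `|f p - f q| = `|p - q|.

Definition symmetry_group U : set (R[i] -> R[i]) :=
  [set f | isometry f /\ f @` origami_structure U = origami_structure U].

Definition joined U p q := exists a m,
  [/\ U a, origami_set U m, line m a p & line m a q].

Definition noncollinear p q r := ~ exists m a,
  [/\ line m a p, line m a q & line m a r].

Definition open_triangle p q r : set R[i] :=
  [set z | exists x y t, [/\ 0 < x, 0 < y, 0 < t, x + y + t = 1
    & z = (x%:C)%C * p + (y%:C)%C * q + (t%:C)%C * r]].

Definition triangle_in U p q r :=
  [/\ noncollinear p q r,
      joined U p q, joined U q r, joined U r p
    & open_triangle p q r `&` origami_structure U = set0].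

Definition dist p q : R := complex.Re `|p - q|.

Definition vertex_angle p q r : R :=
  acos (complex.Re ((q - p) * conjc (r - p)) / (dist p q * dist p r)).

Definition has_angles a1 a2 a3 p q r : Prop :=
  perm_eq [:: vertex_angle p q r; vertex_angle q r p; vertex_angle r p q]
          [:: a1; a2; a3].

Definition scalene p q r :=
  [/\ dist p q <> dist q r, dist q r <> dist r p & dist r p <> dist p q].

Definition isosceles p q r :=
  [\/ dist p q = dist q r, dist q r = dist r p | dist r p = dist p q].

Definition equilateral p q r :=
  dist p q = dist q r /\ dist q r = dist r p.

Definition all_triangles U (P : R[i] -> R[i] -> R[i] -> Prop) :=
  forall p q r, triangle_in U p q r -> P p q r.

Definition translation v z : R[i] := z + v.

Definition rotation c u z : R[i] := c + u * (z - c).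

(* the reflection in the axis [line p a] *)
Definition reflection p a z : R[i] := p + expi (a *+ 2) * conjc (z - p).

Definition glide_reflection p a t z : R[i] :=
  reflection p a z + (t%:C)%C * expi a.

Implicit Type G : set (R[i] -> R[i]).

Definition isometry_group G :=
  [/\ G `<=` isometry, G id,
      forall f g, G f -> G g -> G (f \o g)
    & forall f, G f -> exists2 g, G g & cancel f g /\ cancel g f].

Definition translation_lattice G : set R[i] := [set v | G (translation v)].

Definition independent v w := forall s t : R,
  (s%:C)%C * v + (t%:C)%C * w = 0 -> s = 0 /\ t = 0.

Definition lattice v w : set R[i] :=
  [set z | exists m n : int, z = m%:~R * v + n%:~R * w].

Definition point_group G : set (R[i] -> R[i]) :=
  [set (fun z => f z - f 0) | f in G].

Definition wallpaper_group G :=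
  [/\ isometry_group G,
      exists v w, independent v w /\ translation_lattice G = lattice v w
    & finite_set (point_group G)].

Definition has_rotation_of_order (n : nat) G :=
  exists c u, n.-primitive_root u /\ G (rotation c u).

Definition highest_rotation_order (n : nat) G :=
  has_rotation_of_order n G /\
  forall c u, `|u| = 1 -> G (rotation c u) ->
    exists2 m : nat, (m <= n)%N & m.-primitive_root u.

Definition is_p2 G :=
  [/\ wallpaper_group G,
      highest_rotation_order 2 G,
      forall p a, ~ G (reflection p a)
    & forall p a t, t <> 0 -> ~ G (glide_reflection p a t)].

(* In the last condition the rhombic lattice is centered with respect to the
   mirrors: the diagonals v + w and v - w of the rhombus are parallel to them.
   Equality of lengths alone would also admit pmm on a square lattice, whose
   mirrors are parallel to the sides of the rhombus. *)
Definition is_cmm G :=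
  [/\ wallpaper_group G,
      highest_rotation_order 2 G
    & exists a p q,
      [/\ G (reflection p a), G (reflection q (a + pi / 2))
        & exists v w, [/\ independent v w, translation_lattice G = lattice v w,
            `|v| = `|w|, line 0 a (v + w) & line 0 (a + pi / 2) (v - w)]]].

Definition is_p6m G :=
  [/\ wallpaper_group G,
      exists2 v, v != 0 & translation_lattice G = lattice v (expi (pi / 3) * v),
      has_rotation_of_order 6 G
    & exists p a, G (reflection p a)].

End Origami.

(* Main.v *)
(* Put w = [[0,1]]_{alpha,beta}.  In the coordinates (s, t) of s - t w each of
   the three line directions fixes one of s, t, s - t, so intersecting lines
   never leaves the lattice Z + Z w, and the structure is the affine image of
   the triangular grid where s, t or s - t is an integer; it looks the same
   from each pair of consecutive vectors of the triple 1, -w, w - 1.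

   A line contained in the grid is one of its lines.  Hence a symmetry permutes
   the lattice, and its linear part h sends each of the three vectors to plus
   or minus one of them, of the same length.  A vector whose length differs
   from the other two is therefore sent to plus or minus itself, which leaves
   only +-1 as rotations unless the triangle is equilateral; if the three
   lengths are distinct, h = +-1.  Two vectors of equal length are exchanged by
   a reflection in the direction of their sum. *)
Require Import Defs.
From HB Require Import structures.
From mathcomp Require Import all_boot all_order all_algebra.
From mathcomp Require Import all_classical all_reals all_analysis.
From mathcomp Require Import ring lra zify.

Set Implicit Arguments.
Unset Strict Implicit.
Unset Printing Implicit Defensive.

Import Order.TTheory GRing.Theory Num.Theory.
(* Imported again because all_algebra also defines [isometry]. *)
Import Defs.
Local Open Scope classical_set_scope.
Local Open Scope ring_scope.

(** * Linear isometries and coordinates *)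

Section Plane.
Variable R : realType.
Local Open Scope complex_scope.
Implicit Types (u v w z p q d e : R[i]) (s t a b : R).

Lemma complexP z w :
  complex.Re z = complex.Re w -> complex.Im z = complex.Im w -> z = w.
Proof. by case: z w => [a b] [c d] /= -> ->. Qed.

Lemma eq_normc_sqr z w : `|z| = `|w| <->
  complex.Re z ^+ 2 + complex.Im z ^+ 2 = complex.Re w ^+ 2 + complex.Im w ^+ 2.
Proof.
split=> [E|E]; first by apply: complexI; rewrite !add_Re2_Im2 E.
by rewrite !normc_def E.
Qed.

Lemma norm1_sqr u : `|u| = 1 ->
  complex.Re u ^+ 2 + complex.Im u ^+ 2 = 1.
Proof. by rewrite -normr1 => /eq_normc_sqr ->; rewrite /= expr1n expr0n addr0. Qed.

Lemma norm1_neq0 u : `|u| = 1 -> u != 0.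
Proof. by move=> u1; rewrite -normr_eq0 u1 oner_eq0. Qed.

(* The linear isometries are the maps [orth u c] with [|u| = 1]; the boolean
   [c] tells whether the orientation is reversed. *)
Definition orth u (c : bool) z := u * (if c then conjc z else z).

Lemma orthD u c z w : orth u c (z + w) = orth u c z + orth u c w.
Proof. by rewrite /orth; case: c; rewrite ?rmorphD mulrDr. Qed.

Lemma orthN u c z : orth u c (- z) = - orth u c z.
Proof. by rewrite /orth; case: c; rewrite ?rmorphN mulrN. Qed.

Lemma orthZ u c t z : orth u c (t%:C * z) = t%:C * orth u c z.
Proof. by rewrite /orth; case: c; rewrite ?rmorphM /= ?oppr0 mulrCA. Qed.

Lemma orth_norm u c z : `|u| = 1 -> `|orth u c z| = `|z|.
Proof. by move=> u1; rewrite /orth normrM u1 mul1r; case: c; rewrite ?normcJ. Qed.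

Lemma orth_inj u c : `|u| = 1 -> injective (orth u c).
Proof.
move=> u1 z w /(mulfI (norm1_neq0 u1)).
by case: c => // /(can_inj (@conjcK _)).
Qed.

Lemma isometry_orth u c p : `|u| = 1 -> isometry (fun z => p + orth u c z).
Proof.
by move=> u1 z w; rewrite opprD addrACA subrr add0r -orthN -orthD orth_norm.
Qed.

Lemma isometryP (f : R[i] -> R[i]) : isometry f ->
  exists u c, `|u| = 1 /\ forall z, f z = f 0 + orth u c z.
Proof.
move=> fI.
set u := f 1 - f 0; have u1 : `|u| = 1 by rewrite /u fI subr0 normr1.
have u0 := norm1_neq0 u1.
pose g z := (f z - f 0) / u.
have gI z w : `|g z - g w| = `|z - w|.
  by rewrite /g -mulrBl opprB addrA subrK normrM normfV u1 invr1 mulr1 fI.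
have g0 : g 0 = 0 by rewrite /g subrr mul0r.
have g1 : g 1 = 1 by rewrite /g divff.
(* The normalised map [g] fixes 0 and 1, and the distances to these two points determine a point up
   to conjugation. *)
have gz z : [/\ complex.Re (g z) = complex.Re z
      & complex.Im (g z) ^+ 2 = complex.Im z ^+ 2].
  have /eq_normc_sqr := gI z 0; have /eq_normc_sqr := gI z 1.
  rewrite g0 g1 !subr0; case: (g z) => a b; case: z => c d /= E1 E2.
  have Eac : a = c by lra.
  by split=> //; move: E2; rewrite Eac; lra.
have fE z : f z = f 0 + u * g z by rewrite /g mulrC divfK // addrC subrK.
(* The sign of [Im (g 'i)] settles the orientation: the distance to [g 'i] then fixes the sign of
   [Im (g z)] for every [z]. *)
have [Ri Ii] := gz 'i.
have {}Ii : complex.Im (g 'i) = 1 \/ complex.Im (g 'i) = -1.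
  move: Ii => /= /eqP; rewrite eqf_sqr => /orP[]/eqP; [by left | by right].
exists u; case: Ii => Ii.
- exists false; split=> // z; rewrite fE /orth; congr (_ + _ * _).
  have /eq_normc_sqr := gI z 'i; have [Rz Iz] := gz z.
  have -> : g 'i = 'i by apply: complexP.
  move: Rz Iz; case: (g z) => a b; case: z => c d /= -> E1 E2.
  by apply: complexP => //=; lra.
exists true; split=> // z; rewrite fE /orth; congr (_ + _ * _).
have /eq_normc_sqr := gI z 'i; have [Rz Iz] := gz z.
have -> : g 'i = - 'i by apply: complexP => /=; rewrite ?Ri ?oppr0.
move: Rz Iz; case: (g z) => a b; case: z => c d /= -> E1 E2.
by apply: complexP => //=; lra.
Qed.

Definition symmetries (S : set R[i]) : set (R[i] -> R[i]) :=
  [set f | isometry f /\ f @` S = S].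

Lemma isometry_group_symmetries (S : set R[i]) : isometry_group (symmetries S).
Proof.
split.
- by move=> f [].
- by split=> //; rewrite image_id.
- move=> f g [fI fS] [gI gS]; split; last by rewrite -image_comp gS fS.
  by move=> p q /=; rewrite fI gI.
move=> f [fI fS]; have [u [c [u1 fE]]] := isometryP fI.
have u0 := norm1_neq0 u1.
pose g z := if c then conjc ((z - f 0) / u) else (z - f 0) / u.
have gK : cancel g f.
  move=> z; rewrite fE /g /orth; case: c {fE g}; rewrite ?conjcK.
    by rewrite mulrC divfK // addrC subrK.
  by rewrite mulrC divfK // addrC subrK.
have fK : cancel f g.
  move=> z; rewrite /g fE /orth addrC addKr mulrC mulKf //.
  by case: c {fE g gK}; rewrite ?conjcK.
exists g; last by split.
split; first by move=> p q; rewrite -fI !gK.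
by rewrite -[in LHS]fS image_comp (_ : g \o f = id) ?image_id //; apply/funext.
Qed.

(** * Coordinates in a basis of the plane *)

Definition det v w : R := complex.Re v * complex.Im w - complex.Im v * complex.Re w.

(** Cramer's rule; [coord1] and [coord2] are coordinates in the basis [v], [w] only when
    [det v w != 0], since division by zero yields 0. *)
Definition coord1 v w z : R := det z w / det v w.
Definition coord2 v w z : R := det v z / det v w.

Lemma coordK v w z : det v w != 0 ->
  z = (coord1 v w z)%:C * v + (coord2 v w z)%:C * w.
Proof.
rewrite /coord1 /coord2 /det; case: v w z => [a b] [c d] [x y] /= vw0.
by apply: complexP => /=; field.
Qed.

Lemma coord1E v w s t : det v w != 0 ->
  coord1 v w (s%:C * v + t%:C * w) = s.
Proof. by rewrite /coord1 /det; case: v w => [a b] [c d] /= ?; field. Qed.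

Lemma coord2E v w s t : det v w != 0 ->
  coord2 v w (s%:C * v + t%:C * w) = t.
Proof. by rewrite /coord2 /det; case: v w => [a b] [c d] /= ?; field. Qed.

Lemma coord1_lin v w t p d :
  coord1 v w (p + t%:C * d) = coord1 v w p + t * coord1 v w d.
Proof. by rewrite /coord1 /det; case: p d => [a b] [c e] /=; ring. Qed.

Lemma coord2_lin v w t p d :
  coord2 v w (p + t%:C * d) = coord2 v w p + t * coord2 v w d.
Proof. by rewrite /coord2 /det; case: p d => [a b] [c e] /=; ring. Qed.

Lemma coord1D v w p d : coord1 v w (p + d) = coord1 v w p + coord1 v w d.
Proof. by rewrite /coord1 /det; case: p d => [a b] [c e] /=; ring. Qed.

Lemma coord2D v w p d : coord2 v w (p + d) = coord2 v w p + coord2 v w d.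
Proof. by rewrite /coord2 /det; case: p d => [a b] [c e] /=; ring. Qed.

Lemma coord1Z v w t d : coord1 v w (t%:C * d) = t * coord1 v w d.
Proof. by rewrite /coord1 /det; case: d => [c e] /=; ring. Qed.

Lemma det_independent v w : det v w != 0 -> independent v w.
Proof.
move=> vw0 s t E.
have := coord1E s t vw0; have := coord2E s t vw0; rewrite E.
rewrite /coord1 /coord2 /det /= !mulr0 !mul0r subrr mul0r.
by move=> -> ->.
Qed.

Lemma det_orth u c v w : `|u| = 1 ->
  det (orth u c v) (orth u c w) = (if c then -1 else 1) * det v w.
Proof.
move=> /norm1_sqr; rewrite /det /orth; case: u v w => [x y] [a b] [a' b'].
case: c => /= u1; rewrite ?(mul1r, mulN1r) -[RHS]mul1r -u1; ring.
Qed.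

Lemma det_orth_neq0 u c v w : `|u| = 1 -> det v w != 0 ->
  det (orth u c v) (orth u c w) != 0.
Proof.
by move=> u1 vw0; rewrite det_orth // mulf_neq0 //; case: c;
  rewrite ?oppr_eq0 oner_neq0.
Qed.

End Plane.

(** * The triangular grid and its symmetries *)

Section Grid.
Variable R : realType.
Local Open Scope complex_scope.
Implicit Types (u v w z p q d e : R[i]) (s t a b : R).

(* The lines through the points of the lattice spanned by [v] and [w], in the
   directions [v], [w] and [v + w]. *)
Definition grid v w : set R[i] := [set z |
  [\/ coord1 v w z \is a Num.int, coord2 v w z \is a Num.int
    | coord1 v w z - coord2 v w z \is a Num.int]].

Lemma latticeP v w z : det v w != 0 ->
  lattice v w z <->
  coord1 v w z \is a Num.int /\ coord2 v w z \is a Num.int.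
Proof.
move=> vw0; split=> [[m [n ->]]|[/intrP[m Em] /intrP[n En]]].
  have Eint k : k%:~R = (k%:~R : R)%:C by rewrite rmorph_int.
  by rewrite !Eint coord1E // coord2E // !intr_int.
exists m, n; rewrite [LHS](coordK z vw0) Em En.
by rewrite !rmorph_int.
Qed.

(** * Changes of basis that preserve the grid *)

Lemma detC v w : det w v = - det v w.
Proof. by rewrite /det; ring. Qed.

Lemma detNl v w : det (- v) w = - det v w.
Proof. by case: v w => [a b] [c d]; rewrite /det /=; ring. Qed.

Lemma detNr v w : det v (- w) = - det v w.
Proof. by rewrite detC detNl -detC. Qed.

Lemma detDr v w z : det v (w + z) = det v w + det v z.
Proof. by case: v w z => [a b] [c d] [x y]; rewrite /det /=; ring. Qed.

Lemma detvv v : det v v = 0.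
Proof. by rewrite /det mulrC subrr. Qed.

Lemma det_comb v w a b s t :
  det (a%:C * v + b%:C * w) (s%:C * v + t%:C * w) = (a * t - b * s) * det v w.
Proof. by case: v w => [x y] [x' y']; rewrite /det /=; ring. Qed.

Lemma det_rot v w : det w (- (v + w)) = det v w.
Proof. by rewrite detNr detDr detvv addr0 detC opprK. Qed.

Lemma gridC v w : grid w v = grid v w.
Proof.
have E1 z : coord1 w v z = coord2 v w z.
  by rewrite /coord1 /coord2 [det z v]detC [det w v]detC invrN mulrNN.
have E2 z : coord2 w v z = coord1 v w z.
  by rewrite /coord1 /coord2 [det w z]detC [det w v]detC invrN mulrNN.
apply/seteqP; split=> z; rewrite /grid /= !E1 !E2 => -[]Iz;
  [by apply: Or32 | by apply: Or31 | | by apply: Or32 | by apply: Or31 |];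
  by apply: Or33; rewrite -opprB rpredN.
Qed.

Lemma gridN v w : grid (- v) (- w) = grid v w.
Proof.
have E1 z : coord1 (- v) (- w) z = - coord1 v w z.
  by rewrite /coord1 !(detNl, detNr) opprK mulNr.
have E2 z : coord2 (- v) (- w) z = - coord2 v w z.
  by rewrite /coord2 !(detNl, detNr) opprK mulNr.
by apply/seteqP; split=> z; rewrite /grid /= !E1 !E2 -opprD !rpredN.
Qed.

(** Passing to the next pair of the triple [v], [w], [-(v + w)] permutes the two coordinates and
    their difference up to sign. Together with [gridC] and [gridN] this lets any vector of the
    triple come first. *)
Lemma grid_rot v w : det v w != 0 -> grid w (- (v + w)) = grid v w.
Proof.
move=> vw0.
have E1 z : coord1 w (- (v + w)) z = coord2 v w z - coord1 v w z.
  rewrite /coord1 /coord2 det_rot -mulrBl detNr detDr.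
  by rewrite ![det z _]detC opprD !opprK.
have E2 z : coord2 w (- (v + w)) z = - coord1 v w z.
  by rewrite /coord1 /coord2 det_rot [det w z]detC mulNr.
apply/seteqP; split=> z; rewrite /grid /= !E1 !E2 opprK subrK rpredN -opprB rpredN.
  by case=> ?; [apply: Or33 | apply: Or31 | apply: Or32].
by case=> ?; [apply: Or32 | apply: Or33 | apply: Or31].
Qed.

Lemma grid_orth u c v w : `|u| = 1 -> det v w != 0 ->
  orth u c @` grid v w = grid (orth u c v) (orth u c w).
Proof.
move=> u1 vw0; have uvw0 := det_orth_neq0 c u1 vw0.
apply/seteqP; split=> [_ [z Gz <-]|z Gz].
  move: Gz; rewrite /grid /= [in orth u c z](coordK z vw0) orthD !orthZ.
  by rewrite coord1E // coord2E.
exists ((coord1 (orth u c v) (orth u c w) z)%:C * v +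
        (coord2 (orth u c v) (orth u c w) z)%:C * w); last first.
  by rewrite orthD !orthZ -coordK.
by rewrite /grid /= coord1E // coord2E.
Qed.

Lemma lattice_mem1 v w : lattice v w v.
Proof. by exists 1, 0; rewrite mul1r mul0r addr0. Qed.

Lemma lattice_mem2 v w : lattice v w w.
Proof. by exists 0, 1; rewrite mul1r mul0r add0r. Qed.

Lemma latticeD v w p q : lattice v w p -> lattice v w q -> lattice v w (p + q).
Proof.
move=> [m [n ->]] [m' [n' ->]]; exists (m + m'), (n + n').
by rewrite !rmorphD /=; ring.
Qed.

Lemma latticeN v w p : lattice v w p -> lattice v w (- p).
Proof.
by move=> [m [n ->]]; exists (- m), (- n); rewrite !rmorphN /=; ring.
Qed.

Lemma gridD v w p z : det v w != 0 -> lattice v w p ->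
  grid v w z -> grid v w (z + p).
Proof.
move=> vw0 /(latticeP _ vw0)[p1 p2]; rewrite /grid /= coord1D coord2D => -[]Iz.
- by apply: Or31; rewrite rpredD.
- by apply: Or32; rewrite rpredD.
by apply: Or33; rewrite opprD addrACA rpredD // rpredB.
Qed.

Lemma grid_translation v w p : det v w != 0 -> lattice v w p ->
  (fun z => p + z) @` grid v w = grid v w.
Proof.
move=> vw0 Lp; apply/seteqP; split=> [_ [z Gz <-]|z Gz].
  by rewrite addrC; exact: gridD.
by exists (z - p); [apply: gridD => //; exact: latticeN | rewrite addrC subrK].
Qed.

Lemma grid_lattice_line v w p d t : det v w != 0 -> lattice v w p ->
  d = v \/ d = w -> grid v w (p + t%:C * d).
Proof.
move=> vw0 /(latticeP _ vw0)[p1 p2]; rewrite /grid /=.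
have c1 a b := coord1E a b vw0; have c2 a b := coord2E a b vw0.
move: (c1 1 0) (c1 0 1) (c2 1 0) (c2 0 1).
rewrite /= ?mul1r ?mul0r ?add0r ?addr0 => c11 c10 c21 c20.
rewrite coord1_lin coord2_lin => -[->|->]; last first.
  by apply: Or31; rewrite c10 mulr0 addr0.
by apply: Or32; rewrite c21 mulr0 addr0.
Qed.

(** An affine function of nonzero slope leaves its initial value at once and needs some time to
    reach the next integer; a constant one avoids the integers if its value does. *)
Lemma affine_nonint a s : ~ (s = 0 /\ a \is a Num.int) ->
  exists2 e : R, 0 < e & forall t, 0 < t < e -> a + t * s \isn't a Num.int.
Proof.
have pos b r : 0 < r ->
    exists2 e : R, 0 < e & forall t, 0 < t < e -> b + t * r \isn't a Num.int.
  (* The time needed to climb from [b] to the first integer strictly above it. If [b] is itself an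
     integer, it is avoided because [t] is positive. *)
  move=> r0; exists (((Num.floor b)%:~R + 1 - b) / r).
    by rewrite divr_gt0 // subr_gt0 -intrD1 floorD1_gt.
  move=> t /andP[t0]; rewrite ltr_pdivlMr // ltrBrDl => tr.
  apply/negP => /intrP[m Em].
  have lb := floor_le b; rewrite Em in tr.
  have : b < b + t * r by rewrite ltrDl mulr_gt0.
  rewrite Em => /(le_lt_trans lb); rewrite ltr_int => fm.
  by move: tr; rewrite -intrD1 ltr_int ltzD1 leNgt fm.
case: (ltgtP s 0) => [s0|s0|-> na]; last first.
- exists 1 => // t _; rewrite mulr0 addr0; apply/negP => ?; exact: na.
- by move=> _; exact: pos.
have [|e e0 He] := pos (- a) (- s); first by rewrite oppr_gt0.
move=> _; exists e => // t /He.
by rewrite mulrN -opprD rpredN.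
Qed.

(* Otherwise each of the three coordinates is, along the line, an affine
   function of t that avoids the integers on some interval (0, e). *)
Lemma line_in_grid v w p d : (forall t, grid v w (p + t%:C * d)) ->
  [\/ coord1 v w d = 0 /\ coord1 v w p \is a Num.int,
      coord2 v w d = 0 /\ coord2 v w p \is a Num.int
    | coord1 v w d = coord2 v w d /\
      coord1 v w p - coord2 v w p \is a Num.int].
Proof.
move=> line; apply: contrapT => no.
have [e1 e1_gt0 H1] : exists2 e : R, 0 < e & forall t, 0 < t < e ->
    coord1 v w p + t * coord1 v w d \isn't a Num.int.
  by apply: affine_nonint => ?; apply: no; apply: Or31.
have [e2 e2_gt0 H2] : exists2 e : R, 0 < e & forall t, 0 < t < e ->
    coord2 v w p + t * coord2 v w d \isn't a Num.int.
  by apply: affine_nonint => ?; apply: no; apply: Or32.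
have [e3 e3_gt0 H3] : exists2 e : R, 0 < e & forall t, 0 < t < e ->
    coord1 v w p - coord2 v w p + t * (coord1 v w d - coord2 v w d)
    \isn't a Num.int.
  apply: affine_nonint => -[/eqP]; rewrite subr_eq0 => /eqP ? ?.
  by apply: no; apply: Or33.
pose t := Num.min e1 (Num.min e2 e3) / 2.
have m0 : 0 < Num.min e1 (Num.min e2 e3) by rewrite !lt_min e1_gt0 e2_gt0.
have t0 : 0 < t by rewrite divr_gt0.
have : t < Num.min e1 (Num.min e2 e3) by rewrite ltr_pdivrMr // ltr_pMr // ltr1n.
rewrite !lt_min => /and3P[t1 t2 t3].
case: (line t); rewrite ?coord1_lin ?coord2_lin; apply/negP.
- by apply: H1; rewrite t0.
- by apply: H2; rewrite t0.
rewrite opprD addrACA -mulrBr; by apply: H3; rewrite t0.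
Qed.

(** Through a lattice point run two grid lines, in the directions [v] and [w]. Their images are
    nonparallel lines inside the grid, hence grid lines of different families, so two of the three
    coordinates of [f p] are integers, and then all are. *)
Lemma symmetries_grid_lattice v w f p : det v w != 0 ->
  symmetries (grid v w) f -> lattice v w p -> lattice v w (f p).
Proof.
move=> vw0 [fI fS] Lp; have [u [c [u1 fE]]] := isometryP fI.
have image_line d : d = v \/ d = w ->
    forall t, grid v w (f p + t%:C * orth u c d).
  move=> vw t; rewrite -fS; exists (p + t%:C * d).
    exact: grid_lattice_line.
  by rewrite fE orthD orthZ addrA -fE.
have := det_orth_neq0 c u1 vw0.
have := line_in_grid (image_line v (or_introl erefl)).
have := line_in_grid (image_line w (or_intror erefl)).
set x := coord1 v w (f p); set y := coord2 v w (f p).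
rewrite [in det _ _](coordK (orth u c v) vw0) [in det _ _](coordK (orth u c w) vw0).
set a := coord1 _ _ (orth u c v); set b := coord2 _ _ (orth u c v).
set a' := coord1 _ _ (orth u c w); set b' := coord2 _ _ (orth u c w).
rewrite det_comb mulf_eq0 negb_or => Hw Hv /andP[D0 _].
apply/(latticeP _ vw0); rewrite -/x -/y.
have xE : x = (x - y) + y by rewrite subrK.
have yE : y = x - (x - y) by rewrite opprB addrC subrK.
(* If both image lines belong to the same family, their directions are parallel, against [D0]. *)
case: Hw Hv => -[E1 I1] [][E2 I2];
  first [ by split | by split=> //; rewrite xE rpredD
        | by split=> //; rewrite yE rpredB
        | by case/eqP: D0; rewrite ?E1 ?E2; ring ].
Qed.

Lemma intr_mul_eq1 a b : a \is a Num.int -> b \is a Num.int -> a * b = 1 ->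
  a = 1 \/ a = -1.
Proof.
move=> /intrP[m ->] /intrP[n ->]; rewrite -intrM => /eqP.
rewrite (eqr_int _ _ 1) => /eqP mn1.
have := intUnitRing.unitzPl (etrans (mulrC n m) mn1).
rewrite qualifE /= => /orP[/eqP->|/eqP->].
  by left.
by right.
Qed.

Definition vect_pm e d := d = e \/ d = - e.

(* A symmetry maps v to an integer multiple m e of one of v, w, v + w, and
   its inverse maps e to a lattice vector x with m x = v. *)
Lemma symmetries_grid_basis v w f u c : det v w != 0 ->
  symmetries (grid v w) f -> `|u| = 1 -> (forall z, f z = f 0 + orth u c z) ->
  [\/ vect_pm v (orth u c v), vect_pm w (orth u c v)
    | vect_pm (v + w) (orth u c v)].
Proof.
move=> vw0 fG u1 fE.
have [fI fS] := fG.
have Lf0 : lattice v w (f 0).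
  by apply: symmetries_grid_lattice => //; exists 0, 0; rewrite !mul0r addr0.
have /(latticeP _ vw0)[hv1 hv2] : lattice v w (orth u c v).
  rewrite (_ : orth u c v = f v - f 0); last by rewrite fE addrC addKr.
  apply: latticeD; last exact: latticeN.
  by apply: symmetries_grid_lattice => //; exact: lattice_mem1.
have [_ _ _ /(_ _ fG)[g gG [_ gK]]] := isometry_group_symmetries (grid v w).
have mult e m : lattice v w e -> m \is a Num.int ->
    orth u c v = m%:C * e -> vect_pm e (orth u c v).
  move=> Le mI hv.
  pose x := g (f 0 + e).
  have Lx : lattice v w x.
    by apply: symmetries_grid_lattice => //; exact: latticeD.
  have hx : orth u c x = e by apply: (addrI (f 0)); rewrite -fE gK.
  have : v = m%:C * x by apply: (orth_inj u1 (c := c)); rewrite orthZ hx.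
  move/(congr1 (coord1 v w)); rewrite coord1Z.
  rewrite {1}/coord1 divff // => /esym/intr_mul_eq1.
  have /(latticeP _ vw0)[x1 _] := Lx.
  by case=> // m1; rewrite hv m1; [left|right]; rewrite ?rmorphN rmorph1 ?mulN1r ?mul1r.
have : forall t, grid v w (f 0 + t%:C * orth u c v).
  move=> t; rewrite -fS; exists (0 + t%:C * v); last by rewrite add0r fE orthZ.
  apply: grid_lattice_line => //; last by left.
  by exists 0, 0; rewrite !mul0r addr0.
have hvE := coordK (orth u c v) vw0.
move/line_in_grid => -[][E _].
- apply: Or32; apply: (mult _ _ (lattice_mem2 _ _) hv2).
  by rewrite [LHS]hvE E mul0r add0r.
- apply: Or31; apply: (mult _ _ (lattice_mem1 _ _) hv1).
  by rewrite [LHS]hvE E mul0r addr0.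
apply: Or33; apply: (mult _ _ _ hv1).
  exact: latticeD (lattice_mem1 _ _) (lattice_mem2 _ _).
by rewrite [LHS]hvE -E mulrDr.
Qed.

End Grid.

(** * Wallpaper groups of grids *)

Section Wallpaper.
Variable R : realType.
Local Open Scope complex_scope.
Implicit Types (u v w z p q d e : R[i]) (s t a b : R).

Lemma lattice0 v w : lattice v w 0.
Proof. by exists 0, 0; rewrite !mul0r addr0. Qed.

Lemma det_neq0l v w : det v w != 0 -> v != 0.
Proof. by apply: contraNN => /eqP ->; rewrite /det /= !mul0r subrr. Qed.

Lemma grid_rotC v w : det v w != 0 -> grid (- (v + w)) w = grid v w.
Proof. by move=> vw0; rewrite gridC grid_rot. Qed.

Lemma det_rotC v w : det (- (v + w)) w = - det v w.
Proof. by rewrite detC det_rot. Qed.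

(** The source of all explicit symmetries: a linear isometry that carries the basis to another basis
    of the same grid may be followed by any lattice translation. *)
Lemma symmetries_grid_orth v w u c p : det v w != 0 -> `|u| = 1 ->
  grid (orth u c v) (orth u c w) = grid v w -> lattice v w p ->
  symmetries (grid v w) (fun z => p + orth u c z).
Proof.
move=> vw0 u1 uvw Lp; split; first exact: isometry_orth.
by rewrite -(image_comp (orth u c) (fun z => p + z)) grid_orth // uvw grid_translation.
Qed.

(** The candidates for the image of [v] are plus or minus [v], [w], [v + w], and length is
    preserved. *)
Lemma symmetries_grid_fix v w f u c : det v w != 0 ->
  `|w| <> `|v| -> `|v + w| <> `|v| ->
  symmetries (grid v w) f -> `|u| = 1 -> (forall z, f z = f 0 + orth u c z) ->
  vect_pm v (orth u c v).
Proof.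
move=> vw0 nw nvw fG u1 fE; have nv := orth_norm c v u1.
have [//|[]E|[]E] := symmetries_grid_basis vw0 fG u1 fE;
  by move: nv; rewrite E ?normrN.
Qed.

Lemma translation_lattice_grid v w : det v w != 0 ->
  translation_lattice (symmetries (grid v w)) = lattice v w.
Proof.
move=> vw0; apply/seteqP; split=> p.
  move=> /(symmetries_grid_lattice vw0)/(_ (lattice0 v w)).
  by rewrite /translation add0r.
move=> Lp; have := @symmetries_grid_orth v w 1 false p vw0 (normr1 _).
rewrite /orth !mul1r => /(_ erefl Lp).
by rewrite /translation_lattice /= (_ : translation p = fun z => p + 1 * z) //;
  apply/funext => z; rewrite mul1r addrC.
Qed.

Lemma wallpaper_group_grid v w : det v w != 0 ->
  wallpaper_group (symmetries (grid v w)).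
Proof.
move=> vw0; split; first exact: isometry_group_symmetries.
  exists v, w; split; first exact: det_independent.
  exact: translation_lattice_grid.
(* The six possible images [e] of [v]. Once the orientation is fixed, [e] determines the linear
   part: [u] is [e / v] or [e / conjc v]. *)
pose F := [set` [:: v; - v; w; - w; v + w; - (v + w)]].
have finF : finite_set F by exact: finite_seq.
apply: (@sub_finite_set _ _
  (((fun e => orth (e / v) false) @` F) `|`
   ((fun e => orth (e / conjc v) true) @` F))); last first.
  by rewrite finite_setU; split; exact: finite_image.
move=> _ [f fG <-]; have [fI _] := fG.
have [u [c [u1 fE]]] := isometryP fI.
have Fu : F (orth u c v).
  rewrite /F /= !inE.
  by have [[]->|[]->|[]->] := symmetries_grid_basis vw0 fG u1 fE;
    rewrite eqxx ?orbT.
have v0 := det_neq0l vw0.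
have hE : (fun z => f z - f 0) = orth u c.
  by apply/funext => z; rewrite fE addrC addKr.
rewrite hE; case: c Fu {fE hE} => Fu; [right|left].
  by exists (u * conjc v); rewrite // mulfK // conjc_eq0.
by exists (u * v); rewrite // mulfK.
Qed.

Lemma rotationE p u z : rotation p u z = rotation p u 0 + orth u false z.
Proof. by rewrite /rotation /orth; ring. Qed.

Lemma expi_norm a : `|expi a| = 1 :> R[i].
Proof. by rewrite normc_def /= cos2Dsin2 sqrtr1. Qed.

Lemma expiD a b : expi (a + b) = expi a * expi b :> R[i].
Proof. by apply: complexP => /=; rewrite ?cosD ?sinD //; ring. Qed.

Lemma expi_conj a : expi a * conjc (expi a) = 1 :> R[i].
Proof. by rewrite -sqr_normc expi_norm expr1n. Qed.

Lemma expi0 : expi 0 = 1 :> R[i].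
Proof. by rewrite /expi cos0 sin0. Qed.

Lemma reflectionE p a z :
  reflection p a z = reflection p a 0 + orth (expi (a *+ 2)) true z.
Proof. by rewrite /reflection /orth sub0r rmorphB rmorphN /=; ring. Qed.

Lemma grid_half_turn v w : det v w != 0 ->
  symmetries (grid v w) (rotation 0 (-1)).
Proof.
move=> vw0; have := @symmetries_grid_orth v w (-1) false 0 vw0.
rewrite /orth !mulN1r gridN normrN normr1.
move=> /(_ erefl erefl (lattice0 v w)); congr (symmetries _ _).
by apply/funext => z; rewrite /rotation subr0.
Qed.

Lemma N1_neq1 : (-1 : R[i]) != 1.
Proof. by rewrite -subr_eq0 -opprD oppr_eq0 -mulr2n pnatr_eq0. Qed.

(** A rotation in the group multiplies [v] by [u] and sends it to plus or minus itself, so [u] is 1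
    or -1. *)
Lemma highest_rotation_order2_grid v w : det v w != 0 ->
  `|w| <> `|v| -> `|v + w| <> `|v| ->
  highest_rotation_order 2 (symmetries (grid v w)).
Proof.
move=> vw0 nw nvw; have v0 := det_neq0l vw0.
have prim2 : 2.-primitive_root (-1 : R[i]).
  apply/andP; split=> //; apply/forallP => -[[|[|//]] ?]; rewrite unity_rootE /=.
    by rewrite expr1 (negPf N1_neq1).
  by rewrite sqrrN expr1n !eqxx.
split; first by exists 0, (-1); split => //; exact: grid_half_turn.
move=> p u u1 uG.
have := symmetries_grid_fix vw0 nw nvw uG u1 (rotationE p u).
rewrite /orth; case=> /eqP.
  rewrite -{2}[v]mul1r (inj_eq (mulIf v0)) => /eqP ->.
  exists 1%N => //; apply/andP; split=> //; apply/forallP => -[[|//] ?].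
  by rewrite unity_rootE expr1 eqxx.
by rewrite -mulN1r (inj_eq (mulIf v0)) => /eqP ->; exists 2%N.
Qed.

Lemma grid_p2 v w : det v w != 0 ->
  `|v| <> `|w| -> `|w| <> `|v + w| -> `|v + w| <> `|v| ->
  is_p2 (symmetries (grid v w)).
Proof.
move=> vw0 n1 n2 n3; have wv0 : det w v != 0 by rewrite detC oppr_eq0.
(* Reflections and glide reflections are excluded together: no symmetry reverses the orientation. *)
have noreflect f u : symmetries (grid v w) f -> `|u| = 1 ->
    ~ forall z, f z = f 0 + orth u true z.
  move=> fG u1 fE.
  have hv := symmetries_grid_fix vw0 (nesym n1) n3 fG u1 fE.
  have hw : vect_pm w (orth u true w).
    have wG : symmetries (grid w v) f by rewrite gridC.
    have n2' : `|w + v| <> `|w| by rewrite addrC; exact: nesym.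
    exact: symmetries_grid_fix wv0 n1 n2' wG u1 fE.
  have hvw : vect_pm (- (v + w)) (orth u true (- (v + w))).
    have vwG : symmetries (grid (- (v + w)) w) f by rewrite grid_rotC.
    have vw0' : det (- (v + w)) w != 0 by rewrite det_rotC oppr_eq0.
    have n2' : `|w| <> `|- (v + w)| by rewrite normrN.
    have n3' : `|- (v + w) + w| <> `|- (v + w)|.
      by rewrite opprD addrNK !normrN -opprD normrN; exact: nesym.
    exact: symmetries_grid_fix vw0' n2' n3' vwG u1 fE.
  (* Each of [v], [w], [v + w] is an eigenvector of the linear part; comparing the eigenvalue on the
     sum with those on [v] and [w] shows that all agree, so the linear part is a real scalar. *)
  have [s hz] : exists s : R, forall z, orth u true z = s%:C * z.
    suff [s [sv sw]] : exists s : R, orth u true v = s%:C * v /\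
        orth u true w = s%:C * w.
      exists s => z; rewrite (coordK z vw0) orthD !orthZ sv sw.
      by ring.
    have lin s t r : s%:C * v + t%:C * w = r%:C * (v + w) -> s = t.
      rewrite mulrDr => E.
      have := coord1E s t vw0; have := coord2E s t vw0; rewrite E.
      by rewrite coord1E // coord2E // => <- <-.
    have pm d e : vect_pm d e -> exists s : R, e = s%:C * d.
      by case=> ->; [exists 1 | exists (-1)]; rewrite ?rmorphN rmorph1 ?mulN1r ?mul1r.
    move: (pm _ _ hv) (pm _ _ hw) (pm _ _ hvw) => [s sE] [t tE] [r].
    rewrite orthN orthD sE tE mulrN => /oppr_inj/lin st.
    by exists s; rewrite st.
  have u0 := norm1_neq0 u1.
  (* A scalar map preserves orientation: evaluation at 1 gives [u = s], and evaluation at ['i] gives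
     [- s = s]. *)
  have E1 : u = s%:C by have := hz 1; rewrite /orth conjc1 !mulr1.
  have := hz 'i; rewrite /orth E1 => /(congr1 (@complex.Im R)) /= Es.
  have s0 : s = 0 by lra.
  by move: u0; rewrite E1 s0 eqxx.
split.
- exact: wallpaper_group_grid.
- by apply: highest_rotation_order2_grid => //; exact: nesym.
- by move=> p a /noreflect/(_ (expi_norm _)); apply; exact: reflectionE.
move=> p a t _ /noreflect/(_ (expi_norm _)); apply => z.
by rewrite /glide_reflection reflectionE addrAC.
Qed.

(** The reflection along [v + w] fixes [v + w]. After multiplication by [conjc (v + w)], the two
    sides become [conjc v * (v + w)] and [w * conjc (v + w)], which differ by the difference of the
    squared lengths. *)
Lemma reflection_swap v w a t : `|v| = `|w| -> t != 0 ->
  v + w = t%:C * expi a -> expi (a *+ 2) * conjc v = w.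
Proof.
move=> nvw t0 E.
have s0 : conjc (v + w) != 0.
  rewrite conjc_eq0 E mulf_neq0 ?fmorph_eq0 //.
  exact: norm1_neq0 (expi_norm a).
apply: (mulIf s0).
have us : expi (a *+ 2) * conjc (v + w) = v + w.
  rewrite E (_ : conjc (t%:C * _) = t%:C * conjc (expi a)); last first.
    by rewrite rmorphM /= oppr0.
  rewrite mulr2n expiD.
  rewrite (_ : _ * _ * _ = t%:C * expi a * (expi a * conjc (expi a))); last by ring.
  by rewrite expi_conj mulr1.
rewrite mulrAC us rmorphD /= mulrDl mulrDr -!sqr_normc nvw.
by rewrite addrC.
Qed.

Lemma grid_cmm v w a t : det v w != 0 ->
  `|v| = `|w| -> `|v + w| <> `|v| -> t != 0 -> v + w = t%:C * expi a ->
  is_cmm (symmetries (grid v w)).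
Proof.
move=> vw0 nvw n3 t0 E.
have hv := reflection_swap nvw t0 E.
have hw : expi (a *+ 2) * conjc w = v.
  by apply: (reflection_swap (esym nvw) t0); rewrite addrC.
(* Turning the axis by a right angle composes the reflection with the half turn, which yields the
   second mirror. *)
have half : expi ((a + pi / 2) *+ 2) = - expi (a *+ 2) :> R[i].
  rewrite (_ : (a + pi / 2) *+ 2 = a *+ 2 + pi); last by rewrite mulrnDl [pi / 2 *+ 2]mulr2n -splitr.
  rewrite expiD.
  by rewrite /expi cospi sinpi; apply: complexP => /=; ring.
split; first exact: wallpaper_group_grid.
  (* The vector whose length differs from the other two is [v + w]; up to sign it is moved to the
     first place of the basis. *)
  rewrite -(grid_rotC vw0); apply: highest_rotation_order2_grid.
  - by rewrite det_rotC oppr_eq0.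
  - by rewrite normrN -nvw => /esym.
  - by rewrite opprD addrNK -opprD !normrN; exact: nesym.
exists a, 0, 0; split.
- rewrite (_ : reflection 0 a = fun z => 0 + orth (expi (a *+ 2)) true z).
    apply: symmetries_grid_orth (expi_norm _) _ (lattice0 _ _) => //.
    by rewrite /orth hv hw gridC.
  by apply/funext => z; rewrite /reflection subr0.
- rewrite (_ : reflection 0 _ = fun z => 0 + orth (- expi (a *+ 2)) true z).
    apply: symmetries_grid_orth _ _ (lattice0 _ _) => //.
      by rewrite normrN expi_norm.
    by rewrite /orth !mulNr hv hw gridN gridC.
  by apply/funext => z; rewrite /reflection subr0 half.
exists v, w; split.
- exact: det_independent.
- exact: translation_lattice_grid.
- by [].
- by exists t; rewrite // add0r E.
(* [k] is [v - w] turned back by [a]. As the reflection exchanges [v] and [w], [k] is purely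
   imaginary, so [v - w] is perpendicular to the axis. *)
pose k := (v - w) * conjc (expi a).
have dE : v - w = k * expi a by rewrite /k -mulrA [conjc _ * _]mulrC expi_conj mulr1.
have kJ : conjc k = - k.
  have -> : conjc k = (conjc v - conjc w) * expi a.
    by rewrite /k rmorphM rmorphB /= opprK.
  apply: (mulIf (norm1_neq0 (expi_norm a))).
  rewrite -mulrA -expiD -mulr2n mulrBl ![conjc _ * expi (_ *+ _)]mulrC hv hw.
  by rewrite mulNr -mulrA [conjc _ * _]mulrC expi_conj mulr1 opprB.
exists (complex.Im k); rewrite // add0r dE expiD.
rewrite mulrCA mulrC; congr (_ * _).
move: kJ; case: (k) => x y /= -[/eqP]; rewrite -subr_eq0 opprK -mulr2n mulrn_eq0 /= => /eqP ->.
by rewrite /expi cos_pihalf sin_pihalf; apply: complexP => /=; ring.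
Qed.

(** * The hexagonal grid *)

Lemma cos_pi3 : cos (pi / 3) = 1 / 2 :> R.
Proof.
have p0 := pi_gt0 R.
have c0 : 0 < cos (pi / 3) :> R.
  by apply: cos_gt0_pihalf; apply/andP; split; lra.
(* Since [2 pi / 3 = pi - pi / 3], the double angle formula gives a quadratic equation for the
   cosine with roots 1/2 and -1. *)
have : cos (pi / 3 *+ 2) = - cos (pi / 3) :> R.
  by rewrite -cosDpi -[RHS]cosN -[RHS]cosD2pi; congr cos; rewrite !mulr2n; lra.
rewrite cos_mulr2n => E.
have /eqP : (2 * cos (pi / 3) - 1) * (cos (pi / 3) + 1) = 0 :> R.
  by move: E; rewrite mulr2n; lra.
by rewrite mulf_eq0 => /orP[]/eqP; lra.
Qed.

Lemma expi_pi3_sqr : expi (pi / 3) * expi (pi / 3) = expi (pi / 3) - 1 :> R[i].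
Proof.
have := cos2Dsin2 (pi / 3 : R); rewrite /expi cos_pi3 => E.
by apply: complexP => /=; lra.
Qed.

Lemma grid_p6m : is_p6m (symmetries (grid 1 (- expi (pi / 3) : R[i]))).
Proof.
set om : R[i] := expi (pi / 3).
have p0 := pi_gt0 R.
have s0 : 0 < sin (pi / 3) :> R by apply: sin_gt0_pi; apply/andP; split; lra.
have omm : om * om = om - 1 := expi_pi3_sqr.
have vw0 : det 1 (- om) != 0.
  by rewrite /det /= mul1r mul0r subr0 oppr_eq0 gt_eqF.
have nreal a : om <> a%:C.
  by move/(congr1 (@complex.Im R)) => /= E; move: s0; rewrite E ltxx.
split.
- exact: wallpaper_group_grid.
- exists 1; first exact: oner_neq0.
  rewrite translation_lattice_grid // mulr1.
  by apply/seteqP; split=> _ [m [n ->]]; exists m, (- n); rewrite ?mulr1 mulrNz ?mulrNN ?mulrN ?mulNr.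
- exists 0, om; split.
    have om6 : om ^+ 6 = 1.
      transitivity ((om * om) * (om * om) * (om * om)); first by ring.
      rewrite omm (_ : _ * _ = (om * om) * om - 3 * (om * om) + 3 * om - 1); last by ring.
      rewrite omm mulrBl omm; ring.
    (* The order divides 6. Orders 1 and 2 would make [om] equal to the reals 1 and 2, and order 3
       contradicts [om ^+ 3 = -1]. *)
    have [m mP] := prim_order_exists (isT : (0 < 6)%N) om6.
    have omE := prim_expr_order mP.
    case: m mP omE => [|[|[|[|[|[|[|//]]]]]]] // mP omE _.
    - by case: (nreal 1); rewrite -[LHS]expr1 omE.
    - by case: (nreal 2); rewrite rmorph_nat -(subrK 1 om) -omm -expr2 omE.
    - have : (om * om) * om = 1 by rewrite -omE; ring.
      by rewrite omm mulrBl omm mul1r addrAC subrr add0r => /eqP; rewrite (negPf N1_neq1).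
  (* Multiplication by [om] sends 1 and [- om] to [om] and [1 - om], the negatives of the next pair
     of the triple. *)
  have := @symmetries_grid_orth 1 (- om) om false 0 vw0 (expi_norm _).
  rewrite /orth mulr1 mulrN omm (_ : - (om - 1) = - (- (1 - om))); last by ring.
  rewrite -{1}[om]opprK gridN grid_rot // => /(_ erefl (lattice0 _ _)).
  by congr (symmetries _ _); apply/funext => z; rewrite /rotation subr0.
have omJ : conjc (- om) = - (1 - om).
  by rewrite /om /expi cos_pi3; apply: complexP => /=; lra.
exists 0, 0.
(* Conjugation fixes 1 and exchanges the other two vectors of the triple, [- om] and [om - 1]. *)
have := @symmetries_grid_orth 1 (- om) 1 true 0 vw0 (normr1 _).
rewrite /orth !mul1r conjc1 omJ addrC.
rewrite grid_rot; last by rewrite detC oppr_eq0.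
rewrite gridC => /(_ erefl (lattice0 _ _)).
congr (symmetries _ _); apply/funext => z.
by rewrite /reflection mul0rn expi0 subr0 mul1r.
Qed.

End Wallpaper.

(** * The origami structure *)

Section Lines.
Variable R : realType.
Local Open Scope complex_scope.
Implicit Types (u v w z p q d e : R[i]) (s t a b : R).

Lemma detBr v w z : det v (w - z) = det v w - det v z.
Proof. by rewrite detDr detNr. Qed.

Lemma det_scale t v w : det (t%:C * v) w = t * det v w.
Proof. by rewrite /det; case: v w => [a b] [c d] /=; ring. Qed.

Lemma det_eq0 u v d : det u v != 0 -> det u d = 0 -> det v d = 0 -> d = 0.
Proof.
move=> uv0 ud vd; rewrite (coordK d uv0) /coord1 /coord2 ud [det d v]detC vd.
by rewrite oppr0 !mul0r add0r.
Qed.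

(** The oriented area spanned with the direction vector is constant along the line and separates
    parallel lines. *)
Lemma lineP p a z : line p a z <-> det (expi a) z = det (expi a) p.
Proof.
split=> [[t _ <-]|E].
  by rewrite detDr [X in _ + X]detC det_scale detvv mulr0 oppr0 addr0.
have H := cos2Dsin2 a.
(* The parameter is the scalar product of [z - p] with the unit direction vector. *)
exists (complex.Re (z - p) * cos a + complex.Im (z - p) * sin a) => //.
move: E; rewrite /det; case: z => x y; case: p => x' y' /= E.
have E1 := congr1 ( *%R (cos a)) E; have E2 := congr1 ( *%R (sin a)) E.
have H1 := congr1 ( *%R (x - x')) H; have H2 := congr1 ( *%R (y - y')) H.
by apply: complexP => /=; lra.
Qed.

Lemma line_refl p a : line p a p.
Proof. by apply/lineP. Qed.

Lemma det_expi a b : det (expi a) (expi b) = sin (b - a) :> R.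
Proof. by rewrite /det /= sinB; ring. Qed.

Lemma sin_sub_neq0 a b : 0 <= a < pi -> 0 <= b < pi -> a <> b ->
  sin (b - a) != 0.
Proof.
move=> /andP[a0 ap] /andP[b0 bp] ab.
have [lt_ab|lt_ba|//] := ltgtP a b.
  by rewrite gt_eqF // sin_gt0_pi //; apply/andP; split; lra.
by rewrite -opprB sinN oppr_eq0 gt_eqF // sin_gt0_pi //; apply/andP; split; lra.
Qed.

Lemma same_direction_sin a b : same_direction a b -> sin (a - b) = 0.
Proof.
move=> [k ->]; rewrite addrAC subrr add0r.
have sin_nat n : sin (n%:R * pi) = 0 :> R.
  elim: n => [|n IH]; first by rewrite mul0r sin0.
  by rewrite -addn1 natrD mulrDl mul1r sinDpi IH oppr0.
by case: k => n; rewrite ?NegzE ?rmorphN /= ?mulNr ?sinN sin_nat ?oppr0.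
Qed.

(** Two common points differ by a vector parallel to both directions, hence by 0. *)
Lemma is_meetP a b p q z : 0 <= a < pi -> 0 <= b < pi -> a <> b ->
  line p a z -> line q b z -> is_meet p q a b z.
Proof.
move=> aI bI ab pz qz; have s0 := sin_sub_neq0 aI bI ab.
split; first by move/same_direction_sin; rewrite -opprB sinN => /eqP; rewrite oppr_eq0 (negPf s0).
apply/seteqP; split=> [z' [pz' qz']|_ -> //]; apply/subr0_eq.
apply: (@det_eq0 (expi a) (expi b)); first by rewrite det_expi.
  by rewrite detBr (lineP p a z').1 // (lineP p a z).1 // subrr.
by rewrite detBr (lineP q b z').1 // (lineP q b z).1 // subrr.
Qed.

End Lines.

(** * The origami set as a lattice and its structure as a grid *)

Section Origami.
Variables (R : realType) (alpha beta : R).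
Hypotheses (alpha_gt0 : 0 < alpha) (alpha_lt_beta : alpha < beta)
  (beta_lt_pi : beta < pi).
Local Open Scope complex_scope.
Implicit Types (u v w z p q d e : R[i]) (s t a b : R).

Let U := [set 0; alpha; beta] : set R.

(** Law of sines in the triangle 0, 1, [apex] with base 1, whose angles there are [alpha],
    [pi - beta] and [beta - alpha]. *)
Definition left_side : R := sin beta / sin (beta - alpha).
Definition right_side : R := sin alpha / sin (beta - alpha).

(* The point [[0, 1]]_{alpha, beta}. *)
Definition apex : R[i] := left_side%:C * expi alpha.

Lemma alpha_lt_pi : alpha < pi.
Proof. exact: lt_trans beta_lt_pi. Qed.

Lemma beta_gt0 : 0 < beta.
Proof. exact: lt_trans alpha_lt_beta. Qed.

Lemma sin_alpha_gt0 : 0 < sin alpha.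
Proof. by rewrite sin_gt0_pi // alpha_gt0 alpha_lt_pi. Qed.

Lemma sin_beta_gt0 : 0 < sin beta.
Proof. by rewrite sin_gt0_pi // beta_gt0 beta_lt_pi. Qed.

Lemma sin_rho_gt0 : 0 < sin (beta - alpha).
Proof.
by rewrite sin_gt0_pi // subr_gt0 alpha_lt_beta ltrBlDr (lt_trans beta_lt_pi) ?ltrDl.
Qed.

Lemma left_side_gt0 : 0 < left_side.
Proof. by rewrite divr_gt0 ?sin_beta_gt0 ?sin_rho_gt0. Qed.

Lemma right_side_gt0 : 0 < right_side.
Proof. by rewrite divr_gt0 ?sin_alpha_gt0 ?sin_rho_gt0. Qed.

Lemma apex_sub1 : apex - 1 = right_side%:C * expi beta.
Proof.
have := sin_rho_gt0; rewrite /apex /left_side /right_side sinB => s0.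
have s1 := lt0r_neq0 s0.
by apply: complexP => /=; field.
Qed.

Lemma det_apex : det 1 (- apex) != 0.
Proof.
rewrite detNr oppr_eq0 /det /= !mul0r subr0 addr0 mul1r mulf_neq0 //.
  by rewrite gt_eqF ?left_side_gt0.
by rewrite gt_eqF ?sin_alpha_gt0.
Qed.

(** With the minus sign, the grid directions 1, [- apex] and [1 - apex] have the angles 0, [alpha]
    and [beta]. *)
Let X z := coord1 1 (- apex) z.
Let Y z := coord2 1 (- apex) z.

Definition origami_point s t : R[i] := s%:C * 1 + t%:C * - apex.

Lemma origami_point1 s t : X (origami_point s t) = s.
Proof. exact: coord1E det_apex. Qed.

Lemma origami_point2 s t : Y (origami_point s t) = t.
Proof. exact: coord2E det_apex. Qed.

(** For each of the three angles [a], one of [Y], [X], [X - Y] is a nonzero multiple of the form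
    [det (expi a)], which is constant exactly on the lines of angle [a]. *)
Lemma line0P p z : line p 0 z <-> Y z = Y p.
Proof.
rewrite /Y /coord2; split=> [/lineP|E]; first by rewrite expi0 => ->.
by apply/lineP; rewrite expi0; apply: (divIf det_apex).
Qed.

Lemma line_alphaP p z : line p alpha z <-> X z = X p.
Proof.
have Xl q : det q (- apex) = left_side * det (expi alpha) q.
  by rewrite detNr -detC det_scale.
have l0 : left_side != 0 by rewrite gt_eqF ?left_side_gt0.
rewrite /X /coord1; have := det_apex; set D := det 1 (- apex) => D0.
rewrite !Xl; split=> [/lineP ->//|/(divIf D0)/(mulfI l0)/lineP //].
Qed.

Lemma line_betaP p z : line p beta z <-> X z - Y z = X p - Y p.
Proof.
have Xl q : det q (- apex) - det 1 q = right_side * det (expi beta) q.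
  by rewrite -det_scale -apex_sub1 detNr [RHS]detC detBr [det q 1]detC; ring.
have l0 : right_side != 0 by rewrite gt_eqF ?right_side_gt0.
rewrite /X /Y /coord1 /coord2; have := det_apex; set D := det 1 (- apex) => D0.
by rewrite -!mulrBl !Xl; split=> [/lineP ->//|/(divIf D0)/(mulfI l0)/lineP].
Qed.

Lemma angle_bounds a : U a -> 0 <= a < pi.
Proof.
by case=> [[]|] ->; rewrite ?lexx ?pi_gt0 ?(ltW alpha_gt0) ?alpha_lt_pi
  ?(ltW beta_gt0) ?beta_lt_pi.
Qed.

Lemma U0 : U 0. Proof. by left; left. Qed.
Lemma Ualpha : U alpha. Proof. by left; right. Qed.
Lemma Ubeta : U beta. Proof. by right. Qed.

Lemma lattice_line_int p a z : lattice 1 (- apex) p -> U a -> line p a z ->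
  [\/ a = 0 /\ Y z \is a Num.int, a = alpha /\ X z \is a Num.int
    | a = beta /\ X z - Y z \is a Num.int].
Proof.
move=> /(latticeP _ det_apex)[]; rewrite -/(X p) -/(Y p) => pX pY [[]|] ->.
- by move=> /line0P E; apply: Or31; rewrite E.
- by move=> /line_alphaP E; apply: Or32; rewrite E.
by move=> /line_betaP E; apply: Or33; rewrite E rpredB.
Qed.

(** Two lines of different directions through lattice points make two of [X], [Y], [X - Y] integers
    at their intersection; the third is a sum or difference of these. *)
Lemma origami_stage_lattice n z :
  origami_stage U n z -> lattice 1 (- apex) z.
Proof.
have meet p q a b y : lattice 1 (- apex) p -> lattice 1 (- apex) q ->
    U a -> U b -> is_meet p q a b y -> lattice 1 (- apex) y.
  move=> Lp Lq Ua Ub [ab E].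
  have {}ab : a <> b by move=> eq_ab; apply: ab; exists 0; rewrite eq_ab mul0r addr0.
  have [pz qz] : (line p a `&` line q b) y by rewrite E.
  apply/(latticeP _ det_apex); rewrite -/(X y) -/(Y y).
  have xE : X y = (X y - Y y) + Y y by rewrite subrK.
  have yE : Y y = X y - (X y - Y y) by rewrite opprB addrC subrK.
  move: ab (lattice_line_int Lp Ua pz) (lattice_line_int Lq Ub qz).
  move=> ab [][aE Ia] [][bE Ib]; rewrite {}aE {}bE // in ab;
    by [ | split=> //; rewrite xE rpredD | split=> //; rewrite yE rpredB].
elim: n z => [|n IH] z /=.
  move=> [a [b [Ua Ub]]]; apply: meet => //; first exact: lattice0.
  exact: lattice_mem1.
by move=> [p [q [a [b [/IH Lp /IH Lq Ua Ub]]]]]; apply: meet.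
Qed.

(** A point survives to the next stage as the intersection of two lines through itself. *)
Lemma origami_stage_mono m n z : (m <= n)%N ->
  origami_stage U m z -> origami_stage U n z.
Proof.
move=> /subnK <-; elim: (n - m)%N => // k IH /IH zk.
rewrite addSn; exists z, z, 0, alpha; split=> //; [exact: U0|exact: Ualpha|].
apply: is_meetP; [exact: angle_bounds U0|exact: angle_bounds Ualpha| | exact: line_refl..].
by move=> E; move: alpha_gt0; rewrite -E ltxx.
Qed.

Lemma origami_set_meet p q a b z : origami_set U p -> origami_set U q ->
  U a -> U b -> a <> b -> line p a z -> line q b z -> origami_set U z.
Proof.
move=> [m _ pm] [n _ qn] Ua Ub ab pz qz.
exists (maxn m n).+1 => //; exists p, q, a, b; split=> //.
- exact: origami_stage_mono (leq_maxl _ _) pm.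
- exact: origami_stage_mono (leq_maxr _ _) qn.
by apply: is_meetP => //; exact: angle_bounds.
Qed.

Lemma zero_neq_alpha : 0 <> alpha.
Proof. by move=> E; move: alpha_gt0; rewrite -E ltxx. Qed.

Lemma alpha_neq_beta : alpha <> beta.
Proof. by move=> E; move: alpha_lt_beta; rewrite -E ltxx. Qed.

Lemma zero_neq_beta : 0 <> beta.
Proof. by move=> E; move: beta_gt0; rewrite -E ltxx. Qed.

(** Intersections in coordinates: the digits in the names tell which two of [X], [Y], [X - Y] are
    prescribed. *)
Lemma origami_meet12 p q s t : origami_set U p -> origami_set U q ->
  X p = s -> Y q = t -> origami_set U (origami_point s t).
Proof.
move=> Mp Mq <- <-.
apply: (origami_set_meet Mp Mq Ualpha U0 (nesym zero_neq_alpha)).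
  by apply/line_alphaP; rewrite origami_point1.
by apply/line0P; rewrite origami_point2.
Qed.

Lemma origami_meet13 p q s t : origami_set U p -> origami_set U q ->
  X p = s -> X q - Y q = s - t -> origami_set U (origami_point s t).
Proof.
move=> Mp Mq <- E; apply: (origami_set_meet Mp Mq Ualpha Ubeta alpha_neq_beta).
  by apply/line_alphaP; rewrite origami_point1.
by apply/line_betaP; rewrite origami_point1 origami_point2.
Qed.

Lemma origami_meet23 p q s t : origami_set U p -> origami_set U q ->
  Y p = t -> X q - Y q = s - t -> origami_set U (origami_point s t).
Proof.
move=> Mp Mq <- E; apply: (origami_set_meet Mp Mq U0 Ubeta zero_neq_beta).
  by apply/line0P; rewrite origami_point2.
by apply/line_betaP; rewrite origami_point1 origami_point2.
Qed.

Lemma origami_setE : origami_set U = lattice 1 (- apex).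
Proof.
apply/seteqP; split=> [z [n _]|]; first exact: origami_stage_lattice.
have c1 a b := origami_point1 a b; have c2 a b := origami_point2 a b.
(* Four points of the first stage serve as seeds: 0, 1, [apex] and [1 - apex], with coordinates (0,
   0), (1, 0), (0, -1) and (1, 1). *)
have M0 : origami_set U (origami_point 0 0).
  exists 0%N => //; exists alpha, 0; split; [exact: Ualpha|exact: U0|].
  rewrite /origami_point !mul0r addr0.
  apply: is_meetP; [exact: angle_bounds Ualpha|exact: angle_bounds U0|exact: nesym zero_neq_alpha|exact: line_refl|].
  by exists (-1) => //; rewrite expi0 rmorphN rmorph1 mulr1 subrr.
have M1 : origami_set U (origami_point 1 0).
  exists 0%N => //; exists 0, alpha; split; [exact: U0|exact: Ualpha|].
  rewrite /origami_point !mul0r addr0 mulr1.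
  apply: is_meetP; [exact: angle_bounds U0|exact: angle_bounds Ualpha|exact: zero_neq_alpha| |exact: line_refl].
  by exists 1 => //; rewrite expi0 mulr1 add0r.
have Y0 : Y 0 = 0 by rewrite -(c2 0 0) /origami_point !mul0r addr0.
have X0 : X 0 = 0 by rewrite -(c1 0 0) /origami_point !mul0r addr0.
have X1 : X 1 = 1 by rewrite -(c1 1 0) /origami_point !mul0r addr0 mulr1.
have Y1 : Y 1 = 0 by rewrite -(c2 1 0) /origami_point !mul0r addr0 mulr1.
have Mapex : origami_set U (origami_point 0 (-1)).
  exists 0%N => //; exists alpha, beta; split; [exact: Ualpha|exact: Ubeta|].
  apply: is_meetP; [exact: angle_bounds Ualpha|exact: angle_bounds Ubeta|exact: alpha_neq_beta| |].
    by apply/line_alphaP; rewrite c1.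
  by apply/line_betaP; rewrite c1 c2 X1 Y1; lra.
have Mapex' : origami_set U (origami_point 1 1).
  exists 0%N => //; exists beta, alpha; split; [exact: Ubeta|exact: Ualpha|].
  apply: is_meetP; [exact: angle_bounds Ubeta|exact: angle_bounds Ualpha|exact: nesym alpha_neq_beta| |].
    by apply/line_betaP; rewrite c1 c2 X0 Y0; lra.
  by apply/line_alphaP; rewrite c1 X1.
(* A zigzag along the axis: from (n, 0) build (n, -1), whose line of angle [beta] returns to the
   axis at (n + 1, 0); going through (-n, 1) gives the negative direction. *)
have MX (m : int) : origami_set U (origami_point m%:~R 0).
  elim: m => [//|n IH|n IH].
    have := origami_meet12 IH Mapex (c1 _ _) (c2 _ _).
    move=> /(origami_meet23 M0) M'; apply: M'; rewrite !(c1, c2) //.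
    by rewrite intS intrD; lra.
  have := origami_meet12 IH Mapex' (c1 _ _) (c2 _ _).
  move=> /(origami_meet23 M0) M'; apply: M'; rewrite !(c1, c2) //.
  by rewrite intS opprD intrD; lra.
have MN1 : origami_set U (origami_point (-1) 0) by have := MX (-1).
(* The same zigzag on the other axis, through (-1, n) upwards and (1, -n) downwards. *)
have MY (m : int) : origami_set U (origami_point 0 m%:~R).
  elim: m => [//|n IH|n IH].
    have := origami_meet12 MN1 IH (c1 _ _) (c2 _ _).
    move=> /(origami_meet13 M0) M'; apply: M'; rewrite !(c1, c2) //.
    by rewrite intS intrD; lra.
  have := origami_meet12 M1 IH (c1 _ _) (c2 _ _).
  move=> /(origami_meet13 M0) M'; apply: M'; rewrite !(c1, c2) //.
  by rewrite intS opprD intrD; lra.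
move=> z [m [n ->]].
have := origami_meet12 (MX m) (MY n) (c1 _ _) (c2 _ _).
by rewrite /origami_point !rmorph_int.
Qed.

Lemma origami_structureE : origami_structure U = grid 1 (- apex).
Proof.
apply/seteqP; split=> z; rewrite /origami_structure origami_setE.
  move=> [a Ua [p /(latticeP _ det_apex)[pX pY]]].
  case: Ua => [[]|] ->.
  - by move=> /line0P E; apply: Or32; rewrite -/(Y z) E.
  - by move=> /line_alphaP E; apply: Or31; rewrite -/(X z) E.
  - by move=> /line_betaP E; apply: Or33; rewrite -/(X z) -/(Y z) E rpredB.
have Lp s t : s \is a Num.int -> t \is a Num.int ->
    lattice 1 (- apex) (origami_point s t).
  by move=> ? ?; apply/(latticeP _ det_apex); rewrite -/(X _) -/(Y _) origami_point1 origami_point2.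
(* Each grid line is represented by a lattice point where it meets a coordinate axis. *)
case=> Iz.
- exists alpha; first exact: Ualpha.
  exists (origami_point (X z) 0); first exact: Lp.
  by apply/line_alphaP; rewrite origami_point1.
- exists 0; first exact: U0.
  exists (origami_point 0 (Y z)); first exact: Lp.
  by apply/line0P; rewrite origami_point2.
exists beta; first exact: Ubeta.
exists (origami_point (X z - Y z) 0); first exact: Lp.
by apply/line_betaP; rewrite origami_point1 origami_point2 subr0.
Qed.

(** * Angles of the triangles *)

Lemma vertex_angleC p q r : vertex_angle p q r = vertex_angle p r q.
Proof.
rewrite /vertex_angle [dist p q * _]mulrC; congr (acos (_ / _)).
by case: p => a b; case: q => c d; case: r => e f /=; ring.
Qed.

Lemma norm_polar s a : `|s%:C * expi a| = (`|s|)%:C :> R[i].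
Proof.
by rewrite normrM expi_norm mulr1 normc_def /= expr0n addr0 sqrtr_sqr.
Qed.

Lemma dist_polar p q s a : q - p = s%:C * expi a -> dist p q = `|s|.
Proof. by move=> E; rewrite /dist distrC E norm_polar. Qed.

(** Equal signs of [s] and [t] place both points on the rays of angles [a] and [b], or both on the
    opposite rays; opposite signs would give the supplementary angle. *)
Lemma vertex_angle_polar p q r s t a b :
  q - p = s%:C * expi a -> r - p = t%:C * expi b -> 0 < s * t ->
  vertex_angle p q r = acos (cos (a - b)).
Proof.
move=> E1 E2 st0; rewrite /vertex_angle (dist_polar E1) (dist_polar E2) E1 E2.
rewrite -normrM gtr0_norm //; congr acos.
have st1 := lt0r_neq0 st0; rewrite cosB /=; apply: (mulIf st1).
by rewrite divfK //; ring.
Qed.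

Lemma triangle_angles p q r : p <> q ->
  line p 0 q -> line p alpha r -> line q beta r ->
  [/\ vertex_angle p q r = alpha, vertex_angle q r p = pi - beta
    & vertex_angle r p q = beta - alpha].
Proof.
move=> pq [s _ sE] [t _ tE] [t' _ t'E].
have s0 : s != 0.
  by apply/eqP => s0; apply: pq; rewrite -sE s0 mul0r addr0.
have rho0 := lt0r_neq0 sin_rho_gt0.
have E : s%:C * expi 0 + t'%:C * expi beta = t%:C * expi alpha.
  by apply: (addrI p); rewrite addrA sE t'E tE.
have Er := congr1 (@complex.Re R) E; have Ei := congr1 (@complex.Im R) E.
move: Er Ei; rewrite /= cos0 sin0 => Er Ei.
(* Law of sines: taking the oriented area with [expi beta] eliminates [t']. The sign of [s] is free,
   as the triangle may be turned upside down. *)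
have tE' : t = s * left_side.
  apply: (mulIf rho0); rewrite /left_side mulrA divfK // sinB.
  have E1 := congr1 ( *%R (sin beta)) Er; have E2 := congr1 ( *%R (cos beta)) Ei.
  by lra.
have tE'' : t' = s * right_side.
  apply: (mulIf rho0); rewrite /right_side mulrA divfK // sinB.
  have E1 := congr1 ( *%R (sin alpha)) Er; have E2 := congr1 ( *%R (cos alpha)) Ei.
  by lra.
have ss0 : 0 < s * s by rewrite -expr2 exprn_even_gt0.
have [l0 r0] := (left_side_gt0, right_side_gt0).
have pq_s : q - p = s%:C * expi 0 by rewrite -sE addrC addKr.
have pr_s : r - p = (s * left_side)%:C * expi alpha by rewrite -tE -tE' addrC addKr.
have qr_s : r - q = (s * right_side)%:C * expi beta by rewrite -t'E -tE'' addrC addKr.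
have a_pi := alpha_lt_pi; have b_gt0 := beta_gt0.
have [a_gt0 [ab b_pi]] := (alpha_gt0, (alpha_lt_beta, beta_lt_pi)).
split.
- rewrite (vertex_angle_polar pq_s pr_s); last by rewrite mulrA mulr_gt0.
  by rewrite cosKN ?sub0r ?opprK //; apply/andP; split; lra.
(* Writing the reversed side with angle [pi] keeps the factor [s], so that the product with
   [s * right_side] is positive. *)
- have qp_s : p - q = s%:C * expi pi.
    rewrite -opprB pq_s -mulrN; congr (_ * _).
    by rewrite /expi cos0 sin0 cospi sinpi; apply: complexP => /=; rewrite ?oppr0.
  rewrite (vertex_angle_polar qr_s qp_s); last by rewrite mulrAC mulr_gt0.
  by rewrite cosKN ?opprB //; apply/andP; split; lra.
have rp_s : p - r = (- (s * left_side))%:C * expi alpha.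
  by rewrite -opprB pr_s rmorphN mulNr.
have rq_s : q - r = (- (s * right_side))%:C * expi beta.
  by rewrite -opprB qr_s rmorphN mulNr.
rewrite (vertex_angle_polar rp_s rq_s); last first.
  by rewrite mulrNN mulrACA mulr_gt0 // mulr_gt0.
by rewrite cosKN ?opprB //; apply/andP; split; lra.
Qed.

Lemma line_sym p a z : line p a z -> line z a p.
Proof. by move=> /lineP E; apply/lineP. Qed.

Lemma joined_line p q : joined U p q -> exists2 a, U a & line p a q.
Proof.
move=> [a [m [Ua _ /lineP pE /lineP qE]]]; exists a => //.
by apply/lineP; rewrite pE.
Qed.

(** Two sides of equal angle would make the vertices collinear, so the sides use all three angles of
    [U]. The six assignments reduce to [triangle_angles] by renaming the vertices. *)
Lemma triangles_have_angles :
  all_triangles U (has_angles alpha (beta - alpha) (pi - beta)).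
Proof.
move=> p q r [ncol jpq jqr jrp _].
have col a : ~ (line p a q /\ line q a r).
  move=> [/lineP pq /lineP qr]; apply: ncol; exists p, a.
  by split; apply/lineP; rewrite ?qr ?pq.
have col' a : ~ (line q a r /\ line r a p).
  move=> [/lineP qr /lineP rp]; apply: ncol; exists p, a.
  by split; apply/lineP; rewrite ?rp -?qr.
have col'' a : ~ (line r a p /\ line p a q).
  move=> [/lineP rp /lineP pq]; apply: ncol; exists p, a.
  by split; apply/lineP; rewrite ?pq ?rp.
have [a Ua pq] := joined_line jpq; have [b Ub qr] := joined_line jqr.
have [c Uc rp] := joined_line jrp.
have npq : p <> q.
  by move=> E; apply: (col'' c); rewrite -E; split => //; exact: line_refl.
have nqr : q <> r.
  by move=> E; apply: (col a); rewrite -E; split => //; exact: line_refl.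
have nrp : r <> p.
  by move=> E; apply: (col' b); rewrite -E; split => //; exact: line_refl.
have ab : a <> b by move=> E; apply: (col a); rewrite {2}E.
have bc : b <> c by move=> E; apply: (col' b); rewrite {2}E.
have ca : c <> a by move=> E; apply: (col'' c); rewrite {2}E.
have [[qp rq] pr] := (line_sym pq, line_sym qr, line_sym rp).
rewrite /has_angles.
have tri x y z : x <> y -> line x 0 y -> line x alpha z -> line y beta z ->
    perm_eq [:: alpha; beta - alpha; pi - beta]
      [:: vertex_angle x y z; vertex_angle y z x; vertex_angle z x y].
  move=> xy l1 l2 l3; have [-> -> ->] := triangle_angles xy l1 l2 l3.
  by apply/permP => P /=; lia.
have [Cp Cq Cr] : [/\ vertex_angle p q r = vertex_angle p r q,
    vertex_angle q r p = vertex_angle q p r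
  & vertex_angle r p q = vertex_angle r q p].
  by split; exact: vertex_angleC.
rewrite perm_sym.
case: Ua Ub Uc ab bc ca pq qr rp qp rq pr
  => [[]|] -> [[]|] -> [[]|] -> // _ _ _ pq qr rp qp rq pr.
- apply: (perm_trans (tri q p r (nesym npq) qp qr pr)).
  by apply/permP => P /=; rewrite Cp Cq Cr; lia.
- by apply: (perm_trans (tri p q r npq pq pr qr)); apply/permP => P /=; lia.
- by apply: (perm_trans (tri q r p nqr qr qp rp)); apply/permP => P /=; lia.
- apply: (perm_trans (tri p r q (nesym nrp) pr pq rq)).
  by apply/permP => P /=; rewrite Cp Cq Cr; lia.
- apply: (perm_trans (tri r q p (nesym nqr) rq rp qp)).
  by apply/permP => P /=; rewrite Cp Cq Cr; lia.
by apply: (perm_trans (tri r p q nrp rp rq pq)); apply/permP => P /=; lia.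
Qed.

(** * The unit triangle and the three cases *)

Lemma nonint01 s : 0 < s < 1 -> s \isn't a Num.int.
Proof.
move=> /andP[s0 s1]; apply/negP => /norm_intr_ge1/(_ (lt0r_neq0 s0)).
by rewrite gtr0_norm // leNgt s1.
Qed.

(** Hypotheses on all triangles are applied to this one, whose sides have the lengths of the grid
    vectors 1, [1 - apex] and [- apex]. *)
Lemma unit_triangle : triangle_in U 0 1 apex.
Proof.
have M0 : origami_set U 0 by rewrite origami_setE; exact: lattice0.
have M1 : origami_set U 1 by rewrite origami_setE; exact: lattice_mem1.
have d00 a : det (expi a) 0 = 0 :> R by rewrite /det /= !mulr0 subrr.
split.
- move=> [m [a [/lineP E0 /lineP E1 /lineP E2]]].
  rewrite -E0 d00 in E1 E2.
  suff : expi a = 0 :> R[i].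
    by apply/eqP; apply: norm1_neq0; exact: expi_norm.
  apply: (det_eq0 det_apex); first by rewrite detC E1 oppr0.
  by rewrite detNl detC E2 !oppr0.
- exists 0, 0; split=> //; [exact: U0|exact: line_refl|].
  by exists 1 => //; rewrite expi0 add0r mulr1.
- exists beta, 1; split=> //; [exact: Ubeta|exact: line_refl|].
  by exists right_side => //; rewrite -apex_sub1 addrC subrK.
- exists alpha, 0; split=> //; [exact: Ualpha| |exact: line_refl].
  by exists left_side => //; rewrite add0r.
rewrite origami_structureE; apply/seteqP; split=> // z.
move=> [[x [y [t [x0 y0 t0 sum ->]]]] Gz].
(* In the interior, [X = y], [Y = - t] and [X - Y = y + t = 1 - x] all lie strictly between
   consecutive integers. *)
have E : (x%:C * 0 + y%:C * 1 + t%:C * apex : R[i]) = origami_point y (- t).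
  by rewrite /origami_point mulr0 add0r rmorphN mulrNN.
move: Gz; rewrite E /grid /= -/(X _) -/(Y _) origami_point1 origami_point2.
rewrite opprK rpredN; case; apply/negP; apply: nonint01; apply/andP; split; lra.
Qed.

Lemma dist01 : dist 0 1 = 1 :> R.
Proof. by rewrite /dist sub0r normrN normr1. Qed.

Lemma dist1apex : dist 1 apex = right_side.
Proof. by rewrite (dist_polar apex_sub1) gtr0_norm ?right_side_gt0. Qed.

Lemma distapex0 : dist apex 0 = left_side.
Proof. by rewrite /dist subr0 norm_polar gtr0_norm ?left_side_gt0. Qed.

Lemma norm_apex : `|apex| = left_side%:C.
Proof. by rewrite norm_polar gtr0_norm ?left_side_gt0. Qed.

Lemma norm_1_sub_apex : `|1 - apex| = right_side%:C.
Proof. by rewrite distrC apex_sub1 norm_polar gtr0_norm ?right_side_gt0. Qed.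

Lemma symmetry_groupE : symmetry_group U = symmetries (grid 1 (- apex)).
Proof. by rewrite -origami_structureE. Qed.

Lemma scalene_p2 : all_triangles U (@scalene R) -> is_p2 (symmetry_group U).
Proof.
move=> /(_ _ _ _ unit_triangle); rewrite /scalene dist01 dist1apex distapex0.
move=> [n1 n2 n3]; rewrite symmetry_groupE.
apply: grid_p2; first exact: det_apex.
- by rewrite normr1 normrN norm_apex => /complexI; exact: nesym.
- by rewrite normrN norm_apex norm_1_sub_apex => /complexI; exact: nesym.
by rewrite normr1 norm_1_sub_apex => /complexI; exact: nesym.
Qed.

(** In each case the grid is rewritten in a basis formed by the two equal sides, oriented so that
    their sum is the third side up to sign; one mirror direction is that of this third side. *)
Lemma isosceles_cmm :
  all_triangles U (fun p q r => isosceles p q r /\ ~ equilateral p q r) ->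
  is_cmm (symmetry_group U).
Proof.
move=> /(_ _ _ _ unit_triangle).
rewrite /isosceles /equilateral dist01 dist1apex distapex0 symmetry_groupE.
have l0 : left_side != 0 by rewrite gt_eqF ?left_side_gt0.
have r0 : right_side != 0 by rewrite gt_eqF ?right_side_gt0.
have d0 := det_apex.
have neq s t : s <> t -> s%:C <> t%:C :> R[i] by move=> st /complexI.
move=> [[E|E|E] neql].
- have -> : grid 1 (- apex) = grid 1 (apex - 1).
    rewrite (_ : apex - 1 = - (- apex + 1)); last by rewrite opprD opprK.
    have dC : det (- apex) 1 != 0 by rewrite detC oppr_eq0.
    by rewrite (grid_rot dC) [RHS]gridC.
  apply: (@grid_cmm _ _ _ alpha left_side) => //.
  + by rewrite detBr detvv subr0 -oppr_eq0 -detNr.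
  + by rewrite distrC norm_1_sub_apex normr1 -E.
  + rewrite addrC subrK normr1 norm_apex; apply: (@neq _ 1) => E1; apply: neql.
    by rewrite -E E1.
  by rewrite addrC subrK.
- have -> : grid 1 (- apex) = grid apex (1 - apex).
    by rewrite -(grid_rot d0) -[LHS]gridN !opprK.
  apply: (@grid_cmm _ _ _ 0 1).
  + by rewrite detBr detvv subr0 detC -detNr.
  + by rewrite norm_apex norm_1_sub_apex E.
  + rewrite addrC subrK normr1 norm_apex; apply: (@neq 1) => E1; apply: neql.
    by rewrite E -E1.
  + exact: oner_neq0.
  by rewrite addrC subrK expi0 mulr1.
apply: (@grid_cmm _ _ _ beta (- right_side)) => //.
- by rewrite normr1 normrN norm_apex E.
- rewrite norm_1_sub_apex normr1; apply: (@neq _ 1) => E1; apply: neql.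
  by rewrite E E1.
- by rewrite oppr_eq0.
by rewrite rmorphN mulNr -apex_sub1 opprB.
Qed.

Lemma equilateral_p6m :
  all_triangles U (@equilateral R) -> is_p6m (symmetry_group U).
Proof.
move=> /(_ _ _ _ unit_triangle).
rewrite /equilateral dist01 dist1apex distapex0 symmetry_groupE => -[r1 lr].
have l1 : left_side = 1 by rewrite -lr -r1.
have apexE : apex = expi alpha by rewrite /apex l1 rmorph1 mul1r.
have betaE : expi alpha - 1 = expi beta :> R[i].
  by rewrite -apexE apex_sub1 -r1 rmorph1 mul1r.
(* Both [expi alpha] and [expi alpha - 1] have length 1, and the squared length of the latter is
   [2 - 2 cos alpha]. *)
have cosa : cos alpha = 1 / 2.
  have := cos2Dsin2 alpha; have := cos2Dsin2 beta.
  have := congr1 (@complex.Re R) betaE; have := congr1 (@complex.Im R) betaE.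
  by move=> /= <- <-; lra.
have -> : apex = expi (pi / 3).
  rewrite apexE; congr expi; apply: cos_inj; last by rewrite cosa cos_pi3.
    by rewrite in_itv /= (ltW alpha_gt0) (ltW alpha_lt_pi).
  by rewrite in_itv /=; have := pi_gt0 R => ?; apply/andP; split; lra.
exact: grid_p6m.
Qed.

End Origami.

Theorem theorem4 (R : realType) (alpha beta : R)
    (alpha_gt0 : 0 < alpha) (alpha_lt_beta : alpha < beta)
    (beta_lt_pi : beta < pi) :
  let rho := beta - alpha in
  let gamma := pi - beta in
  let U := [set 0; alpha; beta] : set R in
  [/\ all_triangles U (has_angles alpha rho gamma),
      all_triangles U (@scalene R) -> is_p2 (symmetry_group U),
      all_triangles U (fun p q r => isosceles p q r /\ ~ equilateral p q r) ->
        is_cmm (symmetry_group U)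
    & all_triangles U (@equilateral R) -> is_p6m (symmetry_group U)].
Proof.
move=> rho gamma U; split.
- exact: triangles_have_angles.
- exact: scalene_p2.
- exact: isosceles_cmm.
exact: equilateral_p6m.
Qed.
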